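(* Let $SO(2)$ be the group of rotations about the axis $\mathbf{e}_3$. Let $$L_1=c_{11}+c_{22}+2c_{66},\quad L_2=c_{44}+c_{55},\quad L_3=c_{11}+c_{22}+2c_{12},\quad L_4=c_{13}+c_{23},\quad L_5=c_{33},$$ and $$\begin{aligned} E_1&=c_{34}^2+c_{35}^2,\\ E_2&=(c_{15}+c_{25})^2+(c_{14}+c_{24})^2,\\ E_3&=(c_{15}+c_{46})^2+(c_{24}+c_{56})^2,\\ E_4&=(c_{14}+c_{24})c_{34}+(c_{15}+c_{25})c_{35},\\ E_5&=(c_{15}+c_{46})c_{35}+(c_{24}+c_{56})c_{34},\\ E_6&=(c_{15}+c_{25})(c_{15}+c_{46})+(c_{14}+c_{24})(c_{24}+c_{56}),\\ E_7&=c_{13}^2+c_{23}^2+2c_{36}^2,\\ E_8&=c_{44}^2+c_{55}^2+2c_{45}^2,\\ E_9&=(c_{11}+c_{12})^2+(c_{12}+c_{22})^2+2(c_{16}+c_{26})^2,\\ E_{10}&=c_{13}c_{55}+c_{23}c_{44}+2c_{36}c_{45},\\ E_{11}&=(c_{11}+c_{12})c_{13}+(c_{12}+c_{22})c_{23}+2(c_{16}+c_{26})c_{36},\\ E_{12}&=(c_{11}+c_{12})c_{55}+(c_{12}+c_{22})c_{44}+2(c_{16}+c_{26})c_{45},\\ E_{13}&=c_{11}^2+c_{22}^2+2c_{12}^2+4(c_{16}^2+c_{26}^2+c_{66}^2),\\ E_{14}&=c_{14}^2+c_{24}^2+c_{15}^2+c_{25}^2+2(c_{56}^2+c_{46}^2),\\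 E_{15}&=(c_{44}-c_{55})c_{36}+(c_{13}-c_{23})c_{45},\\ E_{16}&=(c_{13}-c_{23})(c_{16}+c_{26})-(c_{11}-c_{22})c_{36},\\ E_{17}&=(c_{44}-c_{55})(c_{16}+c_{26})+(c_{11}-c_{22})c_{45},\\ E_{18}&=(c_{15}+c_{46})c_{14}-(c_{24}+c_{56})c_{25}-c_{15}c_{56}+c_{24}c_{46},\\ E_{19}&=(c_{15}+c_{46})c_{34}-(c_{24}+c_{56})c_{35},\\ E_{20}&=(c_{15}+c_{25})c_{34}-(c_{14}+c_{24})c_{35}. \end{aligned}$$ Then the 35 quadratic forms consisting of the 15 products $L_aL_b$ $(1\le a\le b\le 5)$ together with $E_1,\dots,E_{20}$ form a complete basis for the 35-dimensional space of quadratic invariants of the elastic moduli under $SO(2)$.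
   Context: Let $\mathbb{E}$ be the 21-dimensional real vector space of fourth-order tensors $(c_{ijkl})$, $i,j,k,l\in\{1,2,3\}$, with the symmetries $c_{ijkl}=c_{jikl}$ and $c_{ijkl}=c_{klij}$ (no positive-definiteness is imposed). Voigt notation: $c_{IJ}=c_{ijkl}$ with $I=1,2,3,4,5,6$ corresponding to $ij=11,22,33,23,31,12$ (and likewise $J$ to $kl$), so $c_{IJ}=c_{JI}$. A rotation $Q$ acts on $\mathbb{E}$ by $c_{ijkl}\mapsto Q_{ip}Q_{jq}Q_{kr}Q_{ls}c_{pqrs}$ (summation over repeated indices). A quadratic invariant under $SO(2)$ is a real quadratic form $\phi$ on $\mathbb{E}$ with $\phi(Q\cdot C)=\phi(C)$ for all rotations $Q$ about the coordinate axis $\mathbf{e}_3$ and all $C\in\mathbb{E}$. *)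

(* Defs.v *)
From HB Require Import structures.
From mathcomp Require Import all_boot all_order all_algebra sesquilinear.
From mathcomp Require Import boolp classical_sets functions reals.

Set Implicit Arguments.
Unset Strict Implicit.
Unset Printing Implicit Defensive.

Import GRing.Theory.
Local Open Scope ring_scope.

(* Bases of subspaces of a possibly infinite-dimensional space: the library's
   [basis_of] requires a finite-dimensional ambient [vectType], and the ambient
   space used below is a space of functions. *)
Section Basis.
Variables (R : nzRingType) (V : lmodType R) (n : nat).

Definition lin_indep (v : n.-tuple V) : Prop :=
  forall a : 'I_n -> R, \sum_(i < n) a i *: v`_i = 0 -> forall i, a i = 0.

Definition spans (v : n.-tuple V) (S : set V) : Prop :=
  forall x, S x <-> exists a : 'I_n -> R, x = \sum_(i < n) a i *: v`_i.

Definition is_basis (v : n.-tuple V) (S : set V) : Prop :=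
  lin_indep v /\ spans v S.

End Basis.

(* Tensor indices 1, 2, 3 are the ordinals 0, 1, 2. *)
Definition ax1 : 'I_3 := @Ordinal 3 0 isT.
Definition ax2 : 'I_3 := @Ordinal 3 1 isT.
Definition ax3 : 'I_3 := @Ordinal 3 2 isT.

Notation tensor4 R := {ffun 'I_3 * 'I_3 * 'I_3 * 'I_3 -> R^o}.

Section Elasticity.
Variable R : realType.

Definition elastic : {pred tensor4 R} := fun c =>
  [forall i : 'I_3, forall j : 'I_3, forall k : 'I_3, forall l : 'I_3,
     (c (i, j, k, l) == c (j, i, k, l)) && (c (i, j, k, l) == c (k, l, i, j))].

Lemma elasticP (c : tensor4 R) :
  reflect (forall i j k l, c (i, j, k, l) = c (j, i, k, l) /\
                           c (i, j, k, l) = c (k, l, i, j))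
          (c \in elastic).
Proof.
apply: (iffP idP) => [h i j k l | h].
  move: h => /forallP/(_ i)/forallP/(_ j)/forallP/(_ k)/forallP/(_ l).
  by case/andP => /eqP ? /eqP.
apply/forallP => i; apply/forallP => j; apply/forallP => k; apply/forallP => l.
by have [h1 h2] := h i j k l; apply/andP; split; apply/eqP.
Qed.

Fact elastic_submod_closed : submod_closed elastic.
Proof.
split; first by apply/elasticP => i j k l; rewrite !ffunE.
move=> a u v /elasticP hu /elasticP hv; apply/elasticP => i j k l.
have [hu1 hu2] := hu i j k l; have [hv1 hv2] := hv i j k l.
by rewrite !ffunE -hu1 -hu2 -hv1 -hv2.
Qed.

HB.instance Definition _ :=
  GRing.isSubmodClosed.Build R (tensor4 R) elastic elastic_submod_closed.

Record elasticity : Type :=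
  Elasticity { etensor :> tensor4 R; _ : etensor \in elastic }.

HB.instance Definition _ := [isSub for etensor].
HB.instance Definition _ := [Choice of elasticity by <:].
HB.instance Definition _ := [SubChoice_isSubLmodule of elasticity by <:].

Lemma elasticity_sym (C : elasticity) i j k l :
  C (i, j, k, l) = C (j, i, k, l) /\ C (i, j, k, l) = C (k, l, i, j).
Proof. exact: (elasticP _ (valP C)). Qed.

Definition rotate_tensor (Q : 'M[R]_3) (c : tensor4 R) : tensor4 R :=
  [ffun x : 'I_3 * 'I_3 * 'I_3 * 'I_3 => let: (i, j, k, l) := x in
     \sum_(p < 3) \sum_(q < 3) \sum_(r < 3) \sum_(s < 3)
        Q i p * Q j q * Q k r * Q l s * c (p, q, r, s)].

Lemma rotate_elastic (Q : 'M[R]_3) (C : elasticity) :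
  rotate_tensor Q C \in elastic.
Proof.
apply/elasticP => i j k l; rewrite !ffunE; split.
  rewrite exchange_big; apply: eq_bigr => p _; apply: eq_bigr => q _.
  apply: eq_bigr => r _; apply: eq_bigr => s _.
  by rewrite (elasticity_sym C q p r s).1 (mulrC (Q i q)).
rewrite pair_bigA [RHS]pair_bigA /=.
under eq_bigr do rewrite pair_bigA /=.
under [RHS]eq_bigr do rewrite pair_bigA /=.
rewrite exchange_big; apply: eq_bigr => -[r s] _; apply: eq_bigr => -[p q] _ /=.
rewrite (elasticity_sym C p q r s).2; congr (_ * _).
by rewrite -[LHS]mulrA [LHS]mulrC !mulrA.
Qed.

Definition rotate (Q : 'M[R]_3) (C : elasticity) : elasticity :=
  Elasticity (rotate_elastic Q C).

Definition rotation_about_e3 (Q : 'M[R]_3) : Prop :=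
  [/\ Q *m Q^T = 1%:M, \det Q = 1
    & Q *m delta_mx ax3 0 = delta_mx ax3 0 :> 'cV[R]_3].

Definition quadratic_form (phi : elasticity -> R^o) : Prop :=
  exists B : {biscalar elasticity}, forall C, phi C = B C C.

Definition SO2_quadratic_invariants : set (elasticity -> R^o) :=
  [set phi | quadratic_form phi /\
     forall Q, rotation_about_e3 Q -> forall C, phi (rotate Q C) = phi C]%classic.

(* Voigt indices keep their usual numbering 1, ..., 6; other naturals are never
   used. *)
Definition voigt_pair (I : nat) : 'I_3 * 'I_3 :=
  nth (ax1, ax1) [:: (ax1, ax1); (ax2, ax2); (ax3, ax3);
                     (ax2, ax3); (ax3, ax1); (ax1, ax2)] I.-1.

Definition voigt (C : elasticity) (I J : nat) : R :=
  let: (i, j) := voigt_pair I in let: (k, l) := voigt_pair J in C (i, j, k, l).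

End Elasticity.

Arguments SO2_quadratic_invariants : clear implicits.

Section Forms.
Variables (R : realType) (C : elasticity R).
Local Notation c := (voigt C).

Definition L1 : R^o := c 1 1 + c 2 2 + 2 * c 6 6.
Definition L2 : R^o := c 4 4 + c 5 5.
Definition L3 : R^o := c 1 1 + c 2 2 + 2 * c 1 2.
Definition L4 : R^o := c 1 3 + c 2 3.
Definition L5 : R^o := c 3 3.

Definition E1 : R^o := c 3 4 ^+ 2 + c 3 5 ^+ 2.
Definition E2 : R^o := (c 1 5 + c 2 5) ^+ 2 + (c 1 4 + c 2 4) ^+ 2.
Definition E3 : R^o := (c 1 5 + c 4 6) ^+ 2 + (c 2 4 + c 5 6) ^+ 2.
Definition E4 : R^o :=
  (c 1 4 + c 2 4) * c 3 4 + (c 1 5 + c 2 5) * c 3 5.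
Definition E5 : R^o :=
  (c 1 5 + c 4 6) * c 3 5 + (c 2 4 + c 5 6) * c 3 4.
Definition E6 : R^o :=
  (c 1 5 + c 2 5) * (c 1 5 + c 4 6) + (c 1 4 + c 2 4) * (c 2 4 + c 5 6).
Definition E7 : R^o := c 1 3 ^+ 2 + c 2 3 ^+ 2 + 2 * c 3 6 ^+ 2.
Definition E8 : R^o := c 4 4 ^+ 2 + c 5 5 ^+ 2 + 2 * c 4 5 ^+ 2.
Definition E9 : R^o :=
  (c 1 1 + c 1 2) ^+ 2 + (c 1 2 + c 2 2) ^+ 2 + 2 * (c 1 6 + c 2 6) ^+ 2.
Definition E10 : R^o :=
  c 1 3 * c 5 5 + c 2 3 * c 4 4 + 2 * c 3 6 * c 4 5.
Definition E11 : R^o :=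
  (c 1 1 + c 1 2) * c 1 3 + (c 1 2 + c 2 2) * c 2 3
  + 2 * (c 1 6 + c 2 6) * c 3 6.
Definition E12 : R^o :=
  (c 1 1 + c 1 2) * c 5 5 + (c 1 2 + c 2 2) * c 4 4
  + 2 * (c 1 6 + c 2 6) * c 4 5.
Definition E13 : R^o :=
  c 1 1 ^+ 2 + c 2 2 ^+ 2 + 2 * c 1 2 ^+ 2
  + 4 * (c 1 6 ^+ 2 + c 2 6 ^+ 2 + c 6 6 ^+ 2).
Definition E14 : R^o :=
  c 1 4 ^+ 2 + c 2 4 ^+ 2 + c 1 5 ^+ 2 + c 2 5 ^+ 2
  + 2 * (c 5 6 ^+ 2 + c 4 6 ^+ 2).
Definition E15 : R^o :=
  (c 4 4 - c 5 5) * c 3 6 + (c 1 3 - c 2 3) * c 4 5.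
Definition E16 : R^o :=
  (c 1 3 - c 2 3) * (c 1 6 + c 2 6) - (c 1 1 - c 2 2) * c 3 6.
Definition E17 : R^o :=
  (c 4 4 - c 5 5) * (c 1 6 + c 2 6) + (c 1 1 - c 2 2) * c 4 5.
Definition E18 : R^o :=
  (c 1 5 + c 4 6) * c 1 4 - (c 2 4 + c 5 6) * c 2 5
  - c 1 5 * c 5 6 + c 2 4 * c 4 6.
Definition E19 : R^o :=
  (c 1 5 + c 4 6) * c 3 4 - (c 2 4 + c 5 6) * c 3 5.
Definition E20 : R^o :=
  (c 1 5 + c 2 5) * c 3 4 - (c 1 4 + c 2 4) * c 3 5.

End Forms.

Definition SO2_forms (R : realType) : 35.-tuple (elasticity R -> R^o) :=
  [tuple
    (fun C => L1 C * L1 C); (fun C => L1 C * L2 C); (fun C => L1 C * L3 C);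
    (fun C => L1 C * L4 C); (fun C => L1 C * L5 C);
    (fun C => L2 C * L2 C); (fun C => L2 C * L3 C); (fun C => L2 C * L4 C);
    (fun C => L2 C * L5 C);
    (fun C => L3 C * L3 C); (fun C => L3 C * L4 C); (fun C => L3 C * L5 C);
    (fun C => L4 C * L4 C); (fun C => L4 C * L5 C);
    (fun C => L5 C * L5 C);
    @E1 R; @E2 R; @E3 R; @E4 R; @E5 R; @E6 R; @E7 R; @E8 R; @E9 R; @E10 R;
    @E11 R; @E12 R; @E13 R; @E14 R; @E15 R; @E16 R; @E17 R; @E18 R; @E19 R;
    @E20 R].

(* Main.v *)
Require Import Defs.
From HB Require Import structures.
From mathcomp Require Import all_boot all_algebra.
From mathcomp Require Import sesquilinear ring lra.
From mathcomp Require Import boolp classical_sets functions reals.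

Set Implicit Arguments.
Unset Strict Implicit.
Unset Printing Implicit Defensive.

Import GRing.Theory Num.Theory.
Local Open Scope ring_scope.

(** The 21 elastic moduli can be arranged into 5 real coordinates and 8 complex
    ones, z_k, on which the rotation with cosine a and sine b acts by
    z_k |-> (a + i b)^w_k z_k, with weights w_k = 0 (five times), 1 (three
    times), 2 (three times), 3 and 4.  The real and imaginary parts of
    conj(z_k) z_l for w_k = w_l are therefore invariant; conversely, since some
    rotation has an angle of which no multiple by 1, ..., 8 is a full turn, the
    polar form of an invariant quadratic form pairs only coordinates of equal
    weight, so that these products span the invariants.  It remains to express
    them through the given 35 forms and conversely. *)

(** * Elasticity tensors and their 21 Voigt components *)

Section Voigt.
Variable R : realType.
Implicit Types (C D : elasticity R) (f : nat -> nat -> R).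

Definition voigt_index (p : 'I_3 * 'I_3) : nat :=
  let: (i, j) := p in
  nth 0%N (nth [::] [:: [:: 1; 6; 5]; [:: 6; 2; 4]; [:: 5; 4; 3]]%N i) j.

Lemma voigt_indexC i j : voigt_index (i, j) = voigt_index (j, i).
Proof. by case: i j => [[|[|[|//]]] ?] [[|[|[|//]]] ?]. Qed.

Lemma voigt_indexK i j :
  voigt_pair (voigt_index (i, j)) = (i, j) \/
  voigt_pair (voigt_index (i, j)) = (j, i).
Proof.
case: i j => [[|[|[|//]]] ?] [[|[|[|//]]] ?]; rewrite /voigt_pair /=;
  by [left; congr pair; apply: val_inj | right; congr pair; apply: val_inj].
Qed.

Lemma voigt_index_bounds p : (0 < voigt_index p <= 6)%N.
Proof. by case: p => -[[|[|[|//]]] ?] [[|[|[|//]]] ?]. Qed.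

Lemma elasticity_voigtE C i j k l :
  C (i, j, k, l) = voigt C (voigt_index (i, j)) (voigt_index (k, l)).
Proof.
have symr i' j' k' l' : C (i', j', k', l') = C (i', j', l', k').
  by rewrite (elasticity_sym C i' j' _ _).2 (elasticity_sym C k' _ _ _).1
             (elasticity_sym C l' _ _ _).2.
rewrite /voigt.
by case: (voigt_indexK i j) => ->; case: (voigt_indexK k l) => ->;
  rewrite // ?[RHS](elasticity_sym C j i _ _).1 // symr.
Qed.

Lemma voigtC C I J : voigt C I J = voigt C J I.
Proof.
rewrite /voigt; case: (voigt_pair I) => i j; case: (voigt_pair J) => k l.
exact: (elasticity_sym C i j k l).2.
Qed.

Lemma eq_elasticity C D :
  (forall I J, (0 < I)%N -> (I <= J)%N -> (J <= 6)%N -> voigt C I J = voigt D I J) -> C = D.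
Proof.
move=> eqCD; apply: val_inj; apply/ffunP => -[[[i j] k] l].
rewrite -!/(etensor _) !elasticity_voigtE.
have /andP[] := voigt_index_bounds (i, j); have /andP[] := voigt_index_bounds (k, l).
move: (voigt_index _) (voigt_index _) => I J J0 J6 I0 I6.
by case: (leqP I J) => [/eqCD|/ltnW/eqCD]; [|rewrite !(voigtC _ I J)]; apply.
Qed.

Lemma voigt_is_linear I J : scalar (fun C => voigt C I J).
Proof.
move=> a C D; rewrite /voigt.
case: (voigt_pair I) => i j; case: (voigt_pair J) => k l.
have -> : etensor (a *: C + D) = a *: etensor C + etensor D.
  by rewrite -[etensor (_ + _)]/(val _) linearP.
by rewrite !ffunE.
Qed.

(** Taking the smaller index first makes the tensor symmetric for every [f], of which only the upper
    triangle is read. *)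
Definition tensor_of_voigt f : tensor4 R :=
  [ffun x : 'I_3 * 'I_3 * 'I_3 * 'I_3 => let: (i, j, k, l) := x in
     f (minn (voigt_index (i, j)) (voigt_index (k, l)))
       (maxn (voigt_index (i, j)) (voigt_index (k, l)))].

Lemma tensor_of_voigt_elastic f : tensor_of_voigt f \in @elastic R.
Proof.
apply/elasticP => i j k l; rewrite !ffunE; split; first by rewrite voigt_indexC.
by rewrite minnC maxnC.
Qed.

Definition elasticity_of_voigt f : elasticity R :=
  Elasticity (tensor_of_voigt_elastic f).

Lemma voigt_indexKV I : (0 < I)%N -> (I <= 6)%N -> voigt_index (voigt_pair I) = I.
Proof. by case: I => [//|[|[|[|[|[|[|//]]]]]]]. Qed.

Lemma voigt_of f I J : (0 < I)%N -> (I <= J)%N -> (J <= 6)%N ->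
  voigt (elasticity_of_voigt f) I J = f I J.
Proof.
move=> I0 IJ J6; rewrite /voigt.
have := voigt_indexKV I0 (leq_trans IJ J6).
have := voigt_indexKV (leq_trans I0 IJ) J6.
case: (voigt_pair I) => i j; case: (voigt_pair J) => k l eqJ eqI.
by rewrite ffunE eqI eqJ; congr f; [apply/minn_idPl | apply/maxn_idPr].
Qed.

End Voigt.

(** * Rotations about the third axis, and complex coordinates of definite weight *)

Section Rotation.
Variable R : realType.
Implicit Types (C D : elasticity R) (a b : R).

Definition rot_mx a b : 'M[R]_3 :=
  \matrix_(i, j) nth 0 (nth [::] [:: [:: a; - b; 0]; [:: b; a; 0]; [:: 0; 0; 1]] i) j.

Lemma det3E (Q : 'M[R]_3) :
  \det Q = Q ax1 ax1 * (Q ax2 ax2 * Q ax3 ax3 - Q ax2 ax3 * Q ax3 ax2)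
          - Q ax1 ax2 * (Q ax2 ax1 * Q ax3 ax3 - Q ax2 ax3 * Q ax3 ax1)
          + Q ax1 ax3 * (Q ax2 ax1 * Q ax3 ax2 - Q ax2 ax2 * Q ax3 ax1).
Proof.
(* On natural-number indices the lifted ordinals of the cofactor expansions compute, so that [ring]
   recognizes equal entries. *)
pose q (i j : nat) := Q (inord i) (inord j).
have qE i j : Q i j = q i j by rewrite /q !inord_val.
rewrite (expand_det_row _ ord0) !big_ord_recl big_ord0 /cofactor.
rewrite !(expand_det_row _ ord0) !big_ord_recl !big_ord0 /cofactor !det_mx11.
by rewrite !mxE !qE /=; ring.
Qed.

Lemma rot_mxP a b : a ^+ 2 + b ^+ 2 = 1 -> rotation_about_e3 (rot_mx a b).
Proof.
move=> ab1; have a2 : a ^+ 2 = 1 - b ^+ 2 by rewrite -ab1 addrK.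
split.
- apply/matrixP => i j; rewrite !mxE !big_ord_recl big_ord0 !mxE.
  by case: i j => [[|[|[|//]]] ?] [[|[|[|//]]] ?] /=; ring: a2.
- by rewrite det3E !mxE /=; ring: a2.
- apply/matrixP => i j; rewrite !mxE !big_ord_recl big_ord0 !mxE.
  by case: i j => [[|[|[|//]]] ?] [[|//] ?] /=; ring.
Qed.

Lemma rotation_about_e3P Q : rotation_about_e3 Q ->
  exists a b, a ^+ 2 + b ^+ 2 = 1 /\ Q = rot_mx a b.
Proof.
case=> QQ1 detQ Qe3.
have Q3 i : Q i ax3 = (i == ax3)%:R.
  have /matrixP/(_ i 0) := Qe3; rewrite !mxE eqxx andbT => <-.
  rewrite (bigD1 ax3) //= mxE !eqxx mulr1 big1 ?addr0 // => j /negPf jN3.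
  by rewrite mxE jN3 mulr0.
have QQ i j : Q i ax1 * Q j ax1 + Q i ax2 * Q j ax2 + Q i ax3 * Q j ax3 = (i == j)%:R.
  have /matrixP/(_ i j) := QQ1; rewrite !mxE => <-.
  rewrite !big_ord_recl big_ord0 !mxE addr0 addrA.
  by do !congr (_ + _); congr (Q _ _ * Q _ _); apply: val_inj.
rewrite det3E !Q3 /= in detQ.
have := (QQ ax1 ax1, QQ ax2 ax2, QQ ax1 ax2, QQ ax3 ax3); rewrite !Q3 /= => -[[[q11 q22] q12] q33].
have sqr2_eq0 (x y : R) : x ^+ 2 + y ^+ 2 = 0 -> x = 0 /\ y = 0.
  move/eqP; rewrite paddr_eq0 ?sqr_ge0 // !sqrf_eq0.
  by case/andP => /eqP -> /eqP ->.
(* The last row has norm 1 and its last entry is already 1. *)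
have [Q31 Q32] : Q ax3 ax1 = 0 /\ Q ax3 ax2 = 0 by apply: sqr2_eq0; lra.
rewrite Q31 Q32 in detQ.
(* The sum of the two squares is the sum of the squared norms of the first two rows minus twice the
   determinant, that is 1 + 1 - 2 = 0. *)
have [/subr0_eq Q22 /eqP] :
    Q ax2 ax2 - Q ax1 ax1 = 0 /\ Q ax1 ax2 + Q ax2 ax1 = 0.
  by apply: sqr2_eq0; lra.
rewrite addr_eq0 => /eqP Q12.
exists (Q ax1 ax1), (Q ax2 ax1); split; first by rewrite Q12 in q11; lra.
apply/matrixP => i j; rewrite mxE.
have E3 (k : 'I_3) : [\/ k = ax1, k = ax2 | k = ax3].
  by case: k => [[|[|[|//]]] ?]; [apply: Or31|apply: Or32|apply: Or33]; apply: val_inj.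
by case: (E3 i) => ->; case: (E3 j) => -> /=; rewrite ?Q3.
Qed.

(* The real and imaginary parts of (a + i b)^n. *)
Fixpoint cpow a b n : R * R :=
  if n is n'.+1 then (a * (cpow a b n').1 - b * (cpow a b n').2,
                      a * (cpow a b n').2 + b * (cpow a b n').1) else (1, 0).

Definition weight : nat -> nat := nth 0%N [:: 0; 0; 0; 0; 0; 1; 1; 1; 2; 2; 2; 3; 4]%N.

(* The coordinates z_k = re k + i im k are the components of the tensor and of its
   traces along powers of e1 + i e2. *)
Definition re k C : R :=
  let c := voigt C in
  nth 0 [:: c 1 1 + c 2 2 + 2 * c 6 6;
            c 4 4 + c 5 5;
            c 1 1 + c 2 2 + 2 * c 1 2;
            c 1 3 + c 2 3;
            c 3 3;
            c 3 5;
            c 1 5 + c 2 5;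
            c 1 5 + c 4 6;
            c 1 3 - c 2 3;
            c 5 5 - c 4 4;
            c 1 1 - c 2 2;
            c 1 5 - c 2 5 - 2 * c 4 6;
            c 1 1 + c 2 2 - 2 * c 1 2 - 4 * c 6 6] k.

Definition im k C : R :=
  let c := voigt C in
  nth 0 [:: 0; 0; 0; 0; 0;
            c 3 4;
            c 1 4 + c 2 4;
            c 2 4 + c 5 6;
            2 * c 3 6;
            2 * c 4 5;
            2 * (c 1 6 + c 2 6);
            c 1 4 - c 2 4 + 2 * c 5 6;
            4 * (c 1 6 - c 2 6)] k.

Lemma re_is_linear k : scalar (re k).
Proof.
move=> a C D.
do 13![case: k => [|k]; first by rewrite /re /= !voigt_is_linear; ring].
by rewrite /re /= nth_nil mulr0 addr0.
Qed.

Lemma im_is_linear k : scalar (im k).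
Proof.
move=> a C D.
do 13![case: k => [|k]; first by rewrite /im /= ?voigt_is_linear; ring].
by rewrite /im /= nth_nil mulr0 addr0.
Qed.

HB.instance Definition _ k := GRing.isLinear.Build R (elasticity R) R *%R (re k)
  (re_is_linear k).
HB.instance Definition _ k := GRing.isLinear.Build R (elasticity R) R *%R (im k)
  (im_is_linear k).

(** Inverse of C |-> (z_k), found by solving first for [s], which is c11 + c22, and for c15 and c24.
    The first row and column are padding, as Voigt indices start at 1; the zeros below the diagonal
    are never read. *)
Definition of_weights (x y : nat -> R) : elasticity R :=
  let s := (2 * x 0%N + x 2%N + x 12%N) / 4 in
  let c15 := (x 11%N + x 6%N + 2 * x 7%N) / 4 in
  let c24 := (y 6%N + 2 * y 7%N - y 11%N) / 4 in
  elasticity_of_voigt (fun I J =>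
    nth 0 (nth [::] [:: [::]
      ; [:: 0; (s + x 10%N) / 2; (x 2%N - s) / 2; (x 3%N + x 8%N) / 2; y 6%N - c24; c15;
            y 10%N / 4 + y 12%N / 8]
      ; [:: 0; 0; (s - x 10%N) / 2; (x 3%N - x 8%N) / 2; c24; x 6%N - c15;
            y 10%N / 4 - y 12%N / 8]
      ; [:: 0; 0; 0; x 4%N; y 5%N; x 5%N; y 8%N / 2]
      ; [:: 0; 0; 0; 0; (x 1%N - x 9%N) / 2; y 9%N / 2; x 7%N - c15]
      ; [:: 0; 0; 0; 0; 0; (x 1%N + x 9%N) / 2; y 7%N - c24]
      ; [:: 0; 0; 0; 0; 0; 0; (x 0%N - s) / 2]] I) J).

Lemma re_of_weights x y k : (k < 13)%N -> re k (of_weights x y) = x k.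
Proof.
do 13![case: k => [_|k]; first by rewrite /re /= !voigt_of //=; field].
by [].
Qed.

Lemma im_of_weights x y k : (k < 13)%N ->
  im k (of_weights x y) = if (4 < k)%N then y k else 0.
Proof.
do 13![case: k => [_|k]; first by rewrite /im /= ?voigt_of //=; field].
by [].
Qed.

Lemma weightsK C : of_weights (re^~ C) (im^~ C) = C.
Proof.
apply: eq_elasticity => I J.
case: I => [//|I] _; do 6?[case: I => [|I]]; last by move=> h1 h2; have := leq_trans h1 h2.
all: do 7?[case: J => [|J]]; rewrite // => _ _; rewrite voigt_of //= /re /im /=; by field.
Qed.

End Rotation.

(** * The action of a rotation on the complex coordinates *)

Section RotationWeights.
Variable R : realType.
Implicit Types (C D : elasticity R) (a b : R).

(** The rotation of a single tensor index, free of summation signs so that nested uses compute. *)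
Definition rot_comb a b (i : 'I_3) (F : 'I_3 -> R) : R :=
  nth 0 [:: a * F ax1 - b * F ax2; b * F ax1 + a * F ax2; F ax3] i.

Lemma rot_mx_sum a b i F : \sum_p rot_mx a b i p * F p = rot_comb a b i F.
Proof.
pose f (n : nat) := F (inord n).
have FE p : F p = f p by rewrite /f inord_val.
rewrite /rot_comb !big_ord_recl big_ord0 !mxE !FE.
by case: i => [[|[|[|//]]] ?] /=; ring.
Qed.

(** The fourfold sum factors into rotations of one index each, which turns a rotated component into
    an explicit polynomial. *)
Lemma rotate_rot_mxE a b C i j k l :
  rotate (rot_mx a b) C (i, j, k, l) =
  rot_comb a b i (fun p => rot_comb a b j (fun q =>
    rot_comb a b k (fun r => rot_comb a b l (fun s => C (p, q, r, s))))).
Proof.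
rewrite ffunE -rot_mx_sum; apply: eq_bigr => p _.
rewrite -rot_mx_sum big_distrr; apply: eq_bigr => q _ /=.
rewrite -rot_mx_sum mulrA big_distrr; apply: eq_bigr => r _ /=.
rewrite -rot_mx_sum mulrA big_distrr; apply: eq_bigr => s _ /=.
by rewrite !mulrA.
Qed.

(** These are the real and imaginary parts of z_k |-> (a + i b)^w_k z_k. For each k < 13 this is a
    polynomial identity modulo a^2 + b^2 = 1; for larger k both coordinates take the default value
    0. *)
Lemma rotate_weights a b k C : a ^+ 2 + b ^+ 2 = 1 ->
  re k (rotate (rot_mx a b) C) =
    (cpow a b (weight k)).1 * re k C - (cpow a b (weight k)).2 * im k C /\
  im k (rotate (rot_mx a b) C) =
    (cpow a b (weight k)).2 * re k C + (cpow a b (weight k)).1 * im k C.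
Proof.
move=> ab1; have a2 : a ^+ 2 = 1 - b ^+ 2 by rewrite -ab1 addrK.
(* Sorting the two Voigt indices leaves a single name for each modulus. *)
have voigtS := (voigtC C 2 1, voigtC C 3 1, voigtC C 4 1, voigtC C 5 1, voigtC C 6 1,
  voigtC C 3 2, voigtC C 4 2, voigtC C 5 2, voigtC C 6 2, voigtC C 4 3,
  voigtC C 5 3, voigtC C 6 3, voigtC C 5 4, voigtC C 6 4, voigtC C 6 5).
do 13![case: k => [|k]; first by
  rewrite /re /im /voigt /= !rotate_rot_mxE /rot_comb /= !elasticity_voigtE /= ?voigtS;
  split; ring: a2].
by rewrite /re /im /= !nth_nil !mulr0 subr0 addr0.
Qed.

End RotationWeights.

(** * Linear combinations and spans in spaces of any dimension *)

Section LinearCombinations.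
Variables (K : nzRingType) (V : lmodType K).

Definition lincomb (s : seq (K * V)) : V := foldr (fun p x => p.1 *: p.2 + x) 0 s.

Definition lin_closed (P : V -> Prop) : Prop :=
  P 0 /\ forall a u v, P u -> P v -> P (a *: u + v).

(** The hypothesis on [s] is a fold so that, on an explicit list, it computes to a conjunction of
    memberships. *)
Lemma lin_closed_lincomb P s : lin_closed P ->
  foldr (fun p Q => P p.2 /\ Q) True s -> P (lincomb s).
Proof. by case=> P0 PL; elim: s => //= p s IHs [Pp Ps]; apply/PL/IHs. Qed.

Lemma lin_closed_sum (P : V -> Prop) n (a : 'I_n -> K) (v : 'I_n -> V) :
  lin_closed P -> (forall i, P (v i)) -> P (\sum_(i < n) a i *: v i).
Proof.
case=> P0 PL Pv; elim/big_ind: _ => // [u w Pu Pw | i _].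
  by rewrite -[u]scale1r; apply: PL.
by rewrite -[_ *: _]addr0; apply: PL.
Qed.

Definition in_span n (v : n.-tuple V) (x : V) : Prop :=
  exists a : 'I_n -> K, x = \sum_(i < n) a i *: v`_i.

Lemma in_span_closed n (v : n.-tuple V) : lin_closed (in_span v).
Proof.
split; first by exists (fun=> 0); rewrite big1 // => i _; rewrite scale0r.
move=> a _ _ [b ->] [c ->]; exists (fun i => a * b i + c i).
by rewrite scaler_sumr -big_split; apply: eq_bigr => i _ /=; rewrite scalerDl scalerA.
Qed.

Lemma in_span_nth n (v : n.-tuple V) i : (i < n)%N -> in_span v v`_i.
Proof.
move=> ltin; exists (fun j => (j == Ordinal ltin)%:R).
rewrite (bigD1 (Ordinal ltin)) //= eqxx scale1r big1 ?addr0 // => j /negPf ->.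
by rewrite scale0r.
Qed.

End LinearCombinations.

Arguments lincomb {K V} s : simpl never.

(** * The linear space of quadratic invariants *)

Section QuadraticForms.
Variable R : realType.
Implicit Types phi psi : elasticity R -> R^o.

Definition scalar_prod (l m : {scalar elasticity R}) C D := l C * m D.

Lemma scalar_prod_bilinear l m : bilinear_for *%R *%R (scalar_prod l m).
Proof.
by split=> C a D D'; rewrite /scalar_prod linearP /= ?mulrDl ?mulrDr ?mulrA // (mulrC _ a).
Qed.

HB.instance Definition _ l m := bilinear_isBilinear.Build R (elasticity R) (elasticity R)
  R *%R *%R (scalar_prod l m) (scalar_prod_bilinear l m).

Definition biscalar_lin (a : R) (f g : {biscalar elasticity R}) C D := a * f C D + g C D.

Lemma biscalar_lin_bilinear a f g : bilinear_for *%R *%R (biscalar_lin a f g).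
Proof.
by split=> C b D D'; rewrite /biscalar_lin ?linearPl ?linearPr /=; ring.
Qed.

HB.instance Definition _ a f g := bilinear_isBilinear.Build R (elasticity R) (elasticity R)
  R *%R *%R (biscalar_lin a f g) (biscalar_lin_bilinear a f g).

Lemma quadratic_form_prod (l m : {scalar elasticity R}) :
  quadratic_form (fun C => l C * m C).
Proof. by exists (scalar_prod l m). Qed.

Lemma SO2_quadratic_invariants_closed : lin_closed (SO2_quadratic_invariants R).
Proof.
split=> [|a phi psi [[f phiE] phi_inv] [[g psiE] psi_inv]].
  split=> //; exists (scalar_prod \0 \0) => C.
  by rewrite -[RHS]/(0 * 0) mul0r.
split=> [|Q rotQ C]; last by rewrite !fctE phi_inv // psi_inv.
by exists (biscalar_lin a f g) => C; rewrite !fctE phiE psiE.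
Qed.

End QuadraticForms.

(** * Invariant products of coordinates of equal weight *)

Section Forms.
Variable R : realType.
Implicit Types (C D : elasticity R).
Local Notation form := (elasticity R -> R^o).

Lemma lincombE (s : seq (R * form)) C :
  lincomb s C = foldr (fun p x => p.1 * p.2 C + x) 0 s.
Proof. by elim: s => // p s IHs; rewrite /lincomb /= -/(lincomb s) fctE IHs. Qed.

(** [dot k l] and [cross k l] are the real and imaginary parts of conj(z_k) z_l. *)
Definition dot k l : form := fun C => re k C * re l C + im k C * im l C.
Definition cross k l : form := fun C => re k C * im l C - im k C * re l C.

Lemma dotC k l : dot k l = dot l k.
Proof. by apply/funext => C; rewrite /dot; ring. Qed.

Lemma crossN k l : cross k l = lincomb [:: (-1, cross l k)].
Proof. by apply/funext => C; rewrite lincombE /= /cross; ring. Qed.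

Lemma cpow_norm (a b : R) n : a ^+ 2 + b ^+ 2 = 1 ->
  (cpow a b n).1 ^+ 2 + (cpow a b n).2 ^+ 2 = 1.
Proof.
move=> ab1; elim: n => [|n IHn] /=; first by ring.
by rewrite -[RHS]mulr1 -{1}ab1 -IHn; ring.
Qed.

(** Both coordinates are multiplied by the same complex number u of modulus 1, and conj(u z_k) (u
    z_l) = conj(z_k) z_l. The same holds for [cross]. *)
Lemma dot_invariant k l : weight k = weight l -> SO2_quadratic_invariants R (dot k l).
Proof.
move=> wkl; split.
  have [f fE] := @quadratic_form_prod R (re k) (re l).
  have [g gE] := @quadratic_form_prod R (im k) (im l).
  by exists (biscalar_lin 1 f g) => C; rewrite /= /biscalar_lin mul1r -fE -gE.
move=> Q /rotation_about_e3P[a [b [ab1 ->]]] C.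
have := cpow_norm (weight l) ab1; rewrite /dot.
have [-> ->] := rotate_weights k C ab1; have [-> ->] := rotate_weights l C ab1.
rewrite wkl; case: (cpow a b _) => c s /= cs1.
by rewrite -[RHS]mul1r -cs1; ring.
Qed.

Lemma cross_invariant k l : weight k = weight l -> SO2_quadratic_invariants R (cross k l).
Proof.
move=> wkl; split.
  have [f fE] := @quadratic_form_prod R (re k) (im l).
  have [g gE] := @quadratic_form_prod R (im k) (re l).
  by exists (biscalar_lin (-1) g f) => C; rewrite /= /biscalar_lin -fE -gE /cross; ring.
move=> Q /rotation_about_e3P[a [b [ab1 ->]]] C.
have := cpow_norm (weight l) ab1; rewrite /cross.
have [-> ->] := rotate_weights k C ab1; have [-> ->] := rotate_weights l C ab1.
rewrite wkl; case: (cpow a b _) => c s /= cs1.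
by rewrite -[RHS]mul1r -cs1; ring.
Qed.

(** The 35 given forms, in their order, through products of the z_k. The coordinates of weight 0 are
    real, so the products L_a L_b are values of [dot]. Mixed entries come from identities such as
    x^2 + y^2 = ((x - y)^2 + (x + y)^2) / 2, where the difference has weight 2 and the sum weight
    0. *)
Definition weight_forms : seq form :=
  [:: dot 0 0; dot 0 1; dot 0 2; dot 0 3; dot 0 4; dot 1 1; dot 1 2; dot 1 3; dot 1 4;
      dot 2 2; dot 2 3; dot 2 4; dot 3 3; dot 3 4; dot 4 4;
      dot 5 5; dot 6 6; dot 7 7; dot 5 6; dot 5 7; dot 6 7;
      lincomb [:: (1 / 2, dot 8 8); (1 / 2, dot 3 3)];
      lincomb [:: (1 / 2, dot 9 9); (1 / 2, dot 1 1)];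
      lincomb [:: (1 / 2, dot 10 10); (1 / 2, dot 2 2)];
      lincomb [:: (1 / 2, dot 8 9); (1 / 2, dot 1 3)];
      lincomb [:: (1 / 2, dot 8 10); (1 / 2, dot 2 3)];
      lincomb [:: (1 / 2, dot 9 10); (1 / 2, dot 1 2)];
      lincomb [:: (1 / 8, dot 12 12); (1 / 2, dot 10 10); (1 / 2, dot 0 0);
                  (3 / 8, dot 2 2); (- (1 / 2), dot 0 2)];
      lincomb [:: (1 / 4, dot 11 11); (3 / 4, dot 6 6); (1, dot 7 7); (-1, dot 6 7)];
      lincomb [:: (1 / 2, cross 8 9)];
      lincomb [:: (1 / 2, cross 8 10)];
      lincomb [:: (- (1 / 2), cross 9 10)];
      lincomb [:: (-1, cross 6 7)]; lincomb [:: (-1, cross 5 7)]; lincomb [:: (-1, cross 5 6)]].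

Lemma SO2_formsE : SO2_forms R = weight_forms :> seq form.
Proof.
rewrite [LHS]/= /weight_forms.
do 35![apply: (congr2 cons); first by apply/funext => C; rewrite ?lincombE /= /dot /cross /re /im /=
  ?/L1 ?/L2 ?/L3 ?/L4 ?/L5 ?/E1 ?/E2 ?/E3 ?/E4 ?/E5 ?/E6 ?/E7 ?/E8 ?/E9 ?/E10 ?/E11
  ?/E12 ?/E13 ?/E14 ?/E15 ?/E16 ?/E17 ?/E18 ?/E19 ?/E20; field].
by [].
Qed.

Lemma SO2_forms_invariant i : (i < 35)%N -> SO2_quadratic_invariants R (SO2_forms R)`_i.
Proof.
(* Every product in the list pairs coordinates of equal weight, which computation confirms. *)
have step k l : weight k = weight l ->
    SO2_quadratic_invariants R (dot k l) /\ SO2_quadratic_invariants R (cross k l).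
  by move=> wkl; split; [apply: dot_invariant | apply: cross_invariant].
rewrite SO2_formsE; do 35![case: i => [_|i]; first by
  (first [exact: (step _ _ _).1
  | apply: lin_closed_lincomb (SO2_quadratic_invariants_closed R) _ => /=;
    repeat match goal with |- _ /\ _ => split end; rewrite //;
    first [exact: (step _ _ _).1 | exact: (step _ _ _).2]])].
by [].
Qed.

End Forms.

(** * Linear independence of the 35 forms *)

Section Independence.
Variable R : realType.

Definition seq_indicator (s : seq nat) : nat -> R := fun k => if has (eqn k) s then 1 else 0.

Lemma dot_of_weights x y k l : (k < 13)%N -> (l < 13)%N ->
  dot k l (of_weights x y) =
  x k * x l + (if (4 < k)%N && (4 < l)%N then y k * y l else 0) :> R.
Proof.
move=> k13 l13; rewrite /dot !re_of_weights // !im_of_weights //.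
by case: (4 < k)%N; case: (4 < l)%N; rewrite /= ?mul0r ?mulr0.
Qed.

Lemma cross_of_weights x y k l : (4 < k < 13)%N -> (4 < l < 13)%N ->
  cross k l (of_weights x y) = x k * y l - y k * x l :> R.
Proof.
case/andP=> k4 k13 /andP[l4 l13].
by rewrite /cross !re_of_weights // !im_of_weights // k4 l4.
Qed.

(* Each evaluation point is chosen so that the resulting equation contains a single
   coefficient that is not yet known to vanish. *)
Ltac probe H A s t :=
  have := H (seq_indicator s) (seq_indicator t);
  repeat match goal with e : A _ = 0 |- _ => rewrite ?e; clear e end;
  rewrite /seq_indicator /=; clear H; lra.

(** The hypothesis is a linear relation between the forms, evaluated at a tensor with arbitrary
    coordinates [x] and [y]. *)
Lemma weight_forms_lin_indep (A : nat -> R) : (forall x y : nat -> R,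
    A 0%N * (x 0%N * x 0%N)
    + A 1%N * (x 0%N * x 1%N)
    + A 2%N * (x 0%N * x 2%N)
    + A 3%N * (x 0%N * x 3%N)
    + A 4%N * (x 0%N * x 4%N)
    + A 5%N * (x 1%N * x 1%N)
    + A 6%N * (x 1%N * x 2%N)
    + A 7%N * (x 1%N * x 3%N)
    + A 8%N * (x 1%N * x 4%N)
    + A 9%N * (x 2%N * x 2%N)
    + A 10%N * (x 2%N * x 3%N)
    + A 11%N * (x 2%N * x 4%N)
    + A 12%N * (x 3%N * x 3%N)
    + A 13%N * (x 3%N * x 4%N)
    + A 14%N * (x 4%N * x 4%N)
    + A 15%N * (x 5%N * x 5%N + y 5%N * y 5%N)
    + A 16%N * (x 6%N * x 6%N + y 6%N * y 6%N)
    + A 17%N * (x 7%N * x 7%N + y 7%N * y 7%N)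
    + A 18%N * (x 5%N * x 6%N + y 5%N * y 6%N)
    + A 19%N * (x 5%N * x 7%N + y 5%N * y 7%N)
    + A 20%N * (x 6%N * x 7%N + y 6%N * y 7%N)
    + A 21%N * (1 / 2 * (x 8%N * x 8%N + y 8%N * y 8%N) + 1 / 2 * (x 3%N * x 3%N))
    + A 22%N * (1 / 2 * (x 9%N * x 9%N + y 9%N * y 9%N) + 1 / 2 * (x 1%N * x 1%N))
    + A 23%N * (1 / 2 * (x 10%N * x 10%N + y 10%N * y 10%N) + 1 / 2 * (x 2%N * x 2%N))
    + A 24%N * (1 / 2 * (x 8%N * x 9%N + y 8%N * y 9%N) + 1 / 2 * (x 1%N * x 3%N))
    + A 25%N * (1 / 2 * (x 8%N * x 10%N + y 8%N * y 10%N) + 1 / 2 * (x 2%N * x 3%N))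
    + A 26%N * (1 / 2 * (x 9%N * x 10%N + y 9%N * y 10%N) + 1 / 2 * (x 1%N * x 2%N))
    + A 27%N * (1 / 8 * (x 12%N * x 12%N + y 12%N * y 12%N)
              + 1 / 2 * (x 10%N * x 10%N + y 10%N * y 10%N) + 1 / 2 * (x 0%N * x 0%N)
              + 3 / 8 * (x 2%N * x 2%N) - 1 / 2 * (x 0%N * x 2%N))
    + A 28%N * (1 / 4 * (x 11%N * x 11%N + y 11%N * y 11%N)
              + 3 / 4 * (x 6%N * x 6%N + y 6%N * y 6%N)
              + (x 7%N * x 7%N + y 7%N * y 7%N) - (x 6%N * x 7%N + y 6%N * y 7%N))
    + A 29%N * (1 / 2 * (x 8%N * y 9%N - y 8%N * x 9%N))
    + A 30%N * (1 / 2 * (x 8%N * y 10%N - y 8%N * x 10%N))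
    + A 31%N * (- (1 / 2) * (x 9%N * y 10%N - y 9%N * x 10%N))
    + A 32%N * (- (x 6%N * y 7%N - y 6%N * x 7%N))
    + A 33%N * (- (x 5%N * y 7%N - y 5%N * x 7%N))
    + A 34%N * (- (x 5%N * y 6%N - y 5%N * x 6%N)) = 0) ->
  forall n, (n < 35)%N -> A n = 0.
Proof.
move=> H n.
(* z_12 and z_11 each occur in a single form, so these two coefficients come first. Then, within
   each weight, squares precede mixed products. *)
have e27 : A 27%N = 0 by probe H A [:: 12]%N (Nil nat).
have e28 : A 28%N = 0 by probe H A [:: 11]%N (Nil nat).
have e21 : A 21%N = 0 by probe H A [:: 8]%N (Nil nat).
have e22 : A 22%N = 0 by probe H A [:: 9]%N (Nil nat).
have e23 : A 23%N = 0 by probe H A [:: 10]%N (Nil nat).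
have e24 : A 24%N = 0 by probe H A [:: 8; 9]%N (Nil nat).
have e25 : A 25%N = 0 by probe H A [:: 8; 10]%N (Nil nat).
have e26 : A 26%N = 0 by probe H A [:: 9; 10]%N (Nil nat).
(* With z_8 = 1 and z_9 = i, [dot 8 9] vanishes and [cross 8 9] equals 1. *)
have e29 : A 29%N = 0 by probe H A [:: 8]%N [:: 9]%N.
have e30 : A 30%N = 0 by probe H A [:: 8]%N [:: 10]%N.
have e31 : A 31%N = 0 by probe H A [:: 9]%N [:: 10]%N.
have e15 : A 15%N = 0 by probe H A [:: 5]%N (Nil nat).
have e16 : A 16%N = 0 by probe H A [:: 6]%N (Nil nat).
have e17 : A 17%N = 0 by probe H A [:: 7]%N (Nil nat).
have e18 : A 18%N = 0 by probe H A [:: 5; 6]%N (Nil nat).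
have e19 : A 19%N = 0 by probe H A [:: 5; 7]%N (Nil nat).
have e20 : A 20%N = 0 by probe H A [:: 6; 7]%N (Nil nat).
have e32 : A 32%N = 0 by probe H A [:: 6]%N [:: 7]%N.
have e33 : A 33%N = 0 by probe H A [:: 5]%N [:: 7]%N.
have e34 : A 34%N = 0 by probe H A [:: 5]%N [:: 6]%N.
(* Only the products L_a L_b are left, again squares first. *)
have e0 : A 0%N = 0 by probe H A [:: 0]%N (Nil nat).
have e5 : A 5%N = 0 by probe H A [:: 1]%N (Nil nat).
have e9 : A 9%N = 0 by probe H A [:: 2]%N (Nil nat).
have e12 : A 12%N = 0 by probe H A [:: 3]%N (Nil nat).
have e14 : A 14%N = 0 by probe H A [:: 4]%N (Nil nat).
have e1 : A 1%N = 0 by probe H A [:: 0; 1]%N (Nil nat).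
have e2 : A 2%N = 0 by probe H A [:: 0; 2]%N (Nil nat).
have e3 : A 3%N = 0 by probe H A [:: 0; 3]%N (Nil nat).
have e4 : A 4%N = 0 by probe H A [:: 0; 4]%N (Nil nat).
have e6 : A 6%N = 0 by probe H A [:: 1; 2]%N (Nil nat).
have e7 : A 7%N = 0 by probe H A [:: 1; 3]%N (Nil nat).
have e8 : A 8%N = 0 by probe H A [:: 1; 4]%N (Nil nat).
have e10 : A 10%N = 0 by probe H A [:: 2; 3]%N (Nil nat).
have e11 : A 11%N = 0 by probe H A [:: 2; 4]%N (Nil nat).
have e13 : A 13%N = 0 by probe H A [:: 3; 4]%N (Nil nat).
by do 35![case: n => [//|n]].
Qed.

Lemma SO2_forms_lin_indep : lin_indep (SO2_forms R).
Proof.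
(* [A] carries the coefficients over to natural numbers, where explicit indices can be substituted;
   only those below 35 matter. *)
move=> a a0; pose A n := a (inord n).
suff A0 n : (n < 35)%N -> A n = 0 by move=> i; rewrite -[i]inord_val; apply: A0.
apply: weight_forms_lin_indep => x y.
have H : \sum_(0 <= i < 35) A i * (weight_forms R)`_i (of_weights x y) = 0.
  transitivity ((\sum_(i < 35) a i *: (SO2_forms R)`_i) (of_weights x y)); last by rewrite a0.
  rewrite big_mkord fct_sumE; apply: eq_bigr => i _.
  by rewrite /A inord_val SO2_formsE.
rewrite -[RHS]H /index_iota /= !big_cons big_nil /= ?lincombE /=.
by rewrite ?dot_of_weights ?cross_of_weights //=; ring.
Qed.

End Independence.

(** * Spanning: products of equal weight through the 35 forms *)

Section Spanning.
Variable R : realType.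
Implicit Types (C D : elasticity R).

Lemma im_scalar k C : (k < 5)%N -> im k C = 0.
Proof. by do 5?[case: k => [|k] //]. Qed.

(** The list [weight_forms] is triangular: each entry can be solved for the one product not obtained
    before it is used. Exchanged pairs follow from the symmetry of [dot] and the antisymmetry of
    [cross]. *)
Lemma in_span_dot_cross k l : (k < 13)%N -> (l < 13)%N -> weight k = weight l ->
  in_span (SO2_forms R) (dot k l) /\ in_span (SO2_forms R) (cross k l).
Proof.
pose inS := in_span (SO2_forms R).
have comb s (f : elasticity R -> R^o) :
    (forall C, f C = lincomb s C) -> foldr (fun p Q => inS p.2 /\ Q) True s -> inS f.
  by move=> /funext -> ?; apply: lin_closed_lincomb (in_span_closed _) _.
have gen i : (i < 35)%N -> inS (weight_forms R)`_i.
  by move=> ?; rewrite -SO2_formsE; apply: in_span_nth.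
pose P k l := inS (dot k l) /\ inS (cross k l).
have sym k' l' : P k' l' -> P l' k'.
  by case=> Pd Pc; split; [rewrite dotC | rewrite crossN; apply: comb (fun=> erefl) _].
(* Coordinates of weight 0 are real, and so is conj(z_k) z_k; in both cases [cross] is the empty
   combination. *)
have scalar k' l' : (k' < 5)%N -> (l' < 5)%N -> inS (dot k' l') -> P k' l'.
  move=> k5 l5; split=> //; apply: (comb [::]) => // C.
  by rewrite lincombE /= /cross !im_scalar //; ring.
have diag k' : inS (dot k' k') -> P k' k'.
  by split=> //; apply: (comb [::]) => // C; rewrite lincombE /= /cross; ring.
have P0_0 : P 0%N 0%N by apply: scalar => //; exact: (gen 0%N).
have P0_1 : P 0%N 1%N by apply: scalar => //; exact: (gen 1%N).
have P0_2 : P 0%N 2%N by apply: scalar => //; exact: (gen 2%N).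
have P0_3 : P 0%N 3%N by apply: scalar => //; exact: (gen 3%N).
have P0_4 : P 0%N 4%N by apply: scalar => //; exact: (gen 4%N).
have P1_1 : P 1%N 1%N by apply: scalar => //; exact: (gen 5%N).
have P1_2 : P 1%N 2%N by apply: scalar => //; exact: (gen 6%N).
have P1_3 : P 1%N 3%N by apply: scalar => //; exact: (gen 7%N).
have P1_4 : P 1%N 4%N by apply: scalar => //; exact: (gen 8%N).
have P2_2 : P 2%N 2%N by apply: scalar => //; exact: (gen 9%N).
have P2_3 : P 2%N 3%N by apply: scalar => //; exact: (gen 10%N).
have P2_4 : P 2%N 4%N by apply: scalar => //; exact: (gen 11%N).
have P3_3 : P 3%N 3%N by apply: scalar => //; exact: (gen 12%N).
have P3_4 : P 3%N 4%N by apply: scalar => //; exact: (gen 13%N).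
have P4_4 : P 4%N 4%N by apply: scalar => //; exact: (gen 14%N).
have P5_5 : P 5%N 5%N by apply: diag; exact: (gen 15%N).
have P6_6 : P 6%N 6%N by apply: diag; exact: (gen 16%N).
have P7_7 : P 7%N 7%N by apply: diag; exact: (gen 17%N).
have P5_6 : P 5%N 6%N.
  split; first exact: (gen 18%N).
  apply: (comb [:: (-1, (weight_forms R)`_34)]) => [C|]; last by split=> //; exact: gen.
  by rewrite lincombE /= lincombE /=; ring.
have P5_7 : P 5%N 7%N.
  split; first exact: (gen 19%N).
  apply: (comb [:: (-1, (weight_forms R)`_33)]) => [C|]; last by split=> //; exact: gen.
  by rewrite lincombE /= lincombE /=; ring.
have P6_7 : P 6%N 7%N.
  split; first exact: (gen 20%N).
  apply: (comb [:: (-1, (weight_forms R)`_32)]) => [C|]; last by split=> //; exact: gen.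
  by rewrite lincombE /= lincombE /=; ring.
have P8_8 : P 8%N 8%N.
  (* Entry 21 is E_7, whence [dot 8 8] = 2 E_7 - [dot 3 3]. The other products of weight 2 are
     isolated in the same way. *)
  apply/diag/(comb [:: (2, (weight_forms R)`_21); (-1, dot 3 3)]) => [C|].
    by rewrite lincombE /= lincombE /=; field.
  by split; [exact: gen | case: P3_3].
have P9_9 : P 9%N 9%N.
  apply/diag/(comb [:: (2, (weight_forms R)`_22); (-1, dot 1 1)]) => [C|].
    by rewrite lincombE /= lincombE /=; field.
  by split; [exact: gen | case: P1_1].
have P10_10 : P 10%N 10%N.
  apply/diag/(comb [:: (2, (weight_forms R)`_23); (-1, dot 2 2)]) => [C|].
    by rewrite lincombE /= lincombE /=; field.
  by split; [exact: gen | case: P2_2].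
have P8_9 : P 8%N 9%N.
  split.
    apply: (comb [:: (2, (weight_forms R)`_24); (-1, dot 1 3)]) => [C|].
      by rewrite lincombE /= lincombE /=; field.
    by split; [exact: gen | case: P1_3].
  apply: (comb [:: (2, (weight_forms R)`_29)]) => [C|]; last by split=> //; exact: gen.
  by rewrite lincombE /= lincombE /=; field.
have P8_10 : P 8%N 10%N.
  split.
    apply: (comb [:: (2, (weight_forms R)`_25); (-1, dot 2 3)]) => [C|].
      by rewrite lincombE /= lincombE /=; field.
    by split; [exact: gen | case: P2_3].
  apply: (comb [:: (2, (weight_forms R)`_30)]) => [C|]; last by split=> //; exact: gen.
  by rewrite lincombE /= lincombE /=; field.
have P9_10 : P 9%N 10%N.
  split.
    apply: (comb [:: (2, (weight_forms R)`_26); (-1, dot 1 2)]) => [C|].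
      by rewrite lincombE /= lincombE /=; field.
    by split; [exact: gen | case: P1_2].
  apply: (comb [:: (-2, (weight_forms R)`_31)]) => [C|]; last by split=> //; exact: gen.
  by rewrite lincombE /= lincombE /=; field.
have P11_11 : P 11%N 11%N.
  apply/diag/(comb [:: (4, (weight_forms R)`_28); (- 3, dot 6 6); (- 4, dot 7 7);
                       (4, dot 6 7)]) => [C|].
    by rewrite lincombE /= lincombE /=; field.
  by split; [exact: gen | case: P6_6 P7_7 P6_7 => ? _ [? _] [? _]].
have P12_12 : P 12%N 12%N.
  apply/diag/(comb [:: (8, (weight_forms R)`_27); (- 4, dot 10 10); (- 4, dot 0 0);
                       (- 3, dot 2 2); (4, dot 0 2)]) => [C|].
    by rewrite lincombE /= lincombE /=; field.
  by split; [exact: gen | case: P10_10 P0_0 P2_2 P0_2 => ? _ [? _] [? _] [? _]].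
(* All pairs k <= l of equal weight are now in the context; any remaining pair is an exchanged one
   or has distinct weights. *)
do 13?[case: k => [|k]]; rewrite // => _;
  do 13?[case: l => [|l]]; rewrite // => _ _;
  first [assumption | apply: sym; assumption].
Qed.

Lemma eq_weights C D : (forall k, (k < 13)%N -> re k C = re k D) ->
  (forall k, (k < 13)%N -> im k C = im k D) -> C = D.
Proof.
move=> eq_re eq_im; rewrite -[C]weightsK -[D]weightsK.
by congr of_weights; apply/funext => k; case: (ltnP k 13) => k13;
  [exact: eq_re | rewrite /re !nth_default | exact: eq_im | rewrite /im !nth_default].
Qed.

(** For k < 13, [re_basis k] has z_k = 1 and all other coordinates 0; [im_basis k] has z_k = i
    instead when k >= 5. For k < 5, where z_k is real, [im_basis k] is 0, so 21 of these 26 tensors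
    are left. *)
Definition re_basis k : elasticity R := of_weights (fun j => (j == k)%:R) (fun=> 0).
Definition im_basis k : elasticity R := of_weights (fun=> 0) (fun j => (j == k)%:R).

Lemma im_basis_scalar k : (k < 5)%N -> im_basis k = 0.
Proof.
move=> k5; apply: eq_weights => j j13; rewrite linear0 ?re_of_weights ?im_of_weights //.
by case: ltnP => // j5; case: eqP => // jk; move: j5; rewrite jk ltnNge -ltnS k5.
Qed.

Lemma basis_expansion C :
  C = \sum_(k < 13) (re k C *: re_basis k + im k C *: im_basis k).
Proof.
apply: eq_weights => j j13; rewrite linear_sum /= (bigD1 (Ordinal j13)) //= big1 ?addr0.
- by rewrite linearD !linearZ /= !re_of_weights //= eqxx /=; ring.
- move=> k /eqP neq; have /negPf jk : j != k by apply/eqP => jk; apply/neq/val_inj.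
  by rewrite linearD !linearZ /= !re_of_weights // jk /=; ring.
- rewrite linearD !linearZ /= !im_of_weights //= eqxx /=.
  by case: (ltnP 4 j) => j4; [ring | rewrite im_scalar //; ring].
- move=> k /eqP neq; have /negPf jk : j != k by apply/eqP => jk; apply/neq/val_inj.
  by rewrite linearD !linearZ /= !im_of_weights // jk /=; case: ltnP => _; ring.
Qed.

(** * The action of one rotation on this basis *)

Section OneRotation.
Variables a b : R.
Hypothesis ab1 : a ^+ 2 + b ^+ 2 = 1.
Local Notation rot := (rotate (rot_mx a b)).

Lemma rotateD C D : rot (C + D) = rot C + rot D.
Proof.
apply: eq_weights => k _; rewrite linearD /= 1?(rotate_weights k _ ab1).1
  1?(rotate_weights k _ ab1).2 !linearD /=.
- by rewrite !(rotate_weights k _ ab1).1; ring.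
- by rewrite !(rotate_weights k _ ab1).2; ring.
Qed.

(** With u = (a + i b)^w_k = c + i s, this is u 1 = c + i s; for [im_basis] it becomes u i = - s + i
    c. *)
Lemma rotate_re_basis k : (k < 13)%N ->
  rot (re_basis k) = (cpow a b (weight k)).1 *: re_basis k + (cpow a b (weight k)).2 *: im_basis k.
Proof.
move=> k13; apply: eq_weights => j j13; rewrite linearD !linearZ /=.
- rewrite (rotate_weights j _ ab1).1 !re_of_weights // !im_of_weights //.
  by case: eqP => [->|_] /=; case: ifP => _; ring.
- rewrite (rotate_weights j _ ab1).2 !re_of_weights // !im_of_weights //.
  case: eqP => [->|_] /=; case: ltnP => k4; try ring.
  (* For k < 5 the tensor [im_basis k] is 0, in agreement with the formula because weight 0 has sine
     0. *)
  by do 5?[case: k k13 k4 => [|k] k13 k4 //=; first by ring].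
Qed.

Lemma rotate_im_basis k : (k < 13)%N ->
  rot (im_basis k) = - (cpow a b (weight k)).2 *: re_basis k + (cpow a b (weight k)).1 *: im_basis k.
Proof.
move=> k13; apply: eq_weights => j j13; rewrite linearD !linearZ /=.
- rewrite (rotate_weights j _ ab1).1 !re_of_weights // !im_of_weights //.
  case: eqP => [->|_] /=; case: ltnP => k4; try ring.
  by do 5?[case: k k13 k4 => [|k] k13 k4 //=; first by ring].
- rewrite (rotate_weights j _ ab1).2 !re_of_weights // !im_of_weights //.
  by case: eqP => [->|_] /=; case: ifP => _; ring.
Qed.

End OneRotation.

(** * The polar form of an invariant on pairs of coordinates *)

(** For z = x + i y the hypotheses read z = (c - i s) z, and the squared modulus of 1 - (c - i s) is
    (1 - c)^2 + s^2 > 0. *)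
Lemma rotation_fixpoint (c s x y : R) :
  x = c * x + s * y -> y = c * y - s * x -> c < 1 -> x = 0 /\ y = 0.
Proof.
move=> xE yE c1; have d_neq0 : (1 - c) ^+ 2 + s ^+ 2 != 0.
  by rewrite lt0r_neq0 // ltr_wpDr ?sqr_ge0 // exprn_gt0 // subr_gt0.
have x0 : (1 - c) * x - s * y = 0 by lra.
have y0 : (1 - c) * y + s * x = 0 by lra.
split; apply: (mulIf d_neq0); rewrite mul0r.
- transitivity ((1 - c) * ((1 - c) * x - s * y) + s * ((1 - c) * y + s * x)); first by ring.
  by rewrite x0 y0 !mulr0 addr0.
- transitivity ((1 - c) * ((1 - c) * y + s * x) - s * ((1 - c) * x - s * y)); first by ring.
  by rewrite x0 y0 !mulr0 subr0.
Qed.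

(* The angle of the rotation (3/5, 4/5) is such that none of its multiples by
   1, ..., 8 is a full turn. *)
Lemma cpow_cos_lt1 m n : (m < 5)%N -> (n < 5)%N ->
  let: (c, s) := cpow (3 / 5) (4 / 5) m in
  let: (c', s') := cpow (3 / 5) (4 / 5) n in
  ((0 < m)%N || (0 < n)%N -> c * c' - s * s' < 1 :> R) /\
  (m != n -> c * c' + s * s' < 1 :> R).
Proof.
(* The two expressions are the cosines of m + n and m - n times the angle, explicit rational numbers
   in each case. *)
do 5?[case: m => [|m] //]; do 5?[case: n => [|n] //]; move=> _ _; split=> //= _; lra.
Qed.

(** [p], [r], [t], [q] stand for the values of an invariant bilinear form on real and imaginary
    basis tensors of weights m and n. Up to orientation, (p - q, r + t) is turned by m + n times the
    angle and (p + q, r - t) by m - n times it. Hence the first pair vanishes unless m = n = 0, and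
    the second unless m = n. *)
Lemma weight_block_invariants m n (p r t q : R) : (m < 5)%N -> (n < 5)%N ->
  let: (c, s) := cpow (3 / 5) (4 / 5) m in
  let: (c', s') := cpow (3 / 5) (4 / 5) n in
  p = c * (c' * p + s' * r) + s * (c' * t + s' * q) ->
  r = c * (- s' * p + c' * r) + s * (- s' * t + c' * q) ->
  t = - s * (c' * p + s' * r) + c * (c' * t + s' * q) ->
  q = - s * (- s' * p + c' * r) + c * (- s' * t + c' * q) ->
  if m == n then (0 < m)%N -> q = p /\ t = - r
  else [/\ p = 0, r = 0, t = 0 & q = 0].
Proof.
move=> m5 n5; have := cpow_cos_lt1 m5 n5.
case: (cpow _ _ m) => c s; case: (cpow _ _ n) => c' s' [sum_lt1 diff_lt1] hp hr ht hq.
have sum0 := @rotation_fixpoint (c * c' - s * s') (c * s' + s * c') (p - q) (r + t).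
have diff0 := @rotation_fixpoint (c * c' + s * s') (c * s' - s * c') (p + q) (r - t).
have {}sum0 : (0 < m)%N || (0 < n)%N -> p - q = 0 /\ r + t = 0.
  move=> /sum_lt1; apply: sum0; lra.
have {}diff0 : m != n -> p + q = 0 /\ r - t = 0.
  move=> /diff_lt1; apply: diff0; lra.
clear hp hr ht hq; case: (eqVneq m n) => [_ m0|mn].
  by have [|? ?] := sum0; [rewrite m0 | split; lra].
have [|? ?] := sum0; last by have [//|? ?] := diff0; split; lra.
by move: mn; clear; case: m n => [|m] [|n].
Qed.

Lemma weight_lt5 k : (weight k < 5)%N.
Proof. by do 13?[case: k => [|k] //]; rewrite /weight /= nth_nil. Qed.

Lemma weight_eq0 k : (k < 13)%N -> weight k = 0%N -> (k < 5)%N.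
Proof. by do 13?[case: k => [|k] //]. Qed.

Lemma invariant_in_span phi : SO2_quadratic_invariants R phi -> in_span (SO2_forms R) phi.
Proof.
case=> -[B phiE] phi_inv.
have closed := in_span_closed (SO2_forms R).
(* [B] may be neither symmetric nor invariant, but its symmetrization is determined by [phi] and
   inherits the invariance. *)
pose S C D := B C D + B D C.
have SP C D : S C D = phi (C + D) - phi C - phi D.
  by rewrite !phiE linearDl /= !linearDr /S; ring.
have SDl C C' D : S (C + C') D = S C D + S C' D by rewrite /S linearDl linearDr /=; ring.
have SC C D : S C D = S D C by rewrite /S addrC.
have SZl x C D : S (x *: C) D = x * S C D by rewrite /S linearZl_LR linearZr_LR /=; ring.
have SDr C D D' : S C (D + D') = S C D + S C D' by rewrite SC SDl !(SC C).
have SZr x C D : S C (x *: D) = x * S C D by rewrite SC SZl SC.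
have SE x y z w C D C' D' : S (x *: C + y *: D) (z *: C' + w *: D') =
    x * (z * S C C' + w * S C D') + y * (z * S D C' + w * S D D').
  by rewrite SDl !SDr !SZl !SZr; ring.
have S0l D : S 0 D = 0 by rewrite -(scale0r 0) SZl mul0r.
have S0r D : S D 0 = 0 by rewrite SC S0l.
have ab1 : (3 / 5) ^+ 2 + (4 / 5) ^+ 2 = 1 :> R by field.
have S_inv C D : S (rotate (rot_mx (3 / 5) (4 / 5)) C) (rotate (rot_mx (3 / 5) (4 / 5)) D) = S C D.
  by rewrite !SP -rotateD // !phi_inv //; apply: rot_mxP.
have block (k l : 'I_13) C :
    S (re k C *: re_basis k + im k C *: im_basis k) (re l C *: re_basis l + im l C *: im_basis l) =
    if weight k == weight l then
      S (re_basis k) (re_basis l) * dot k l C + S (re_basis k) (im_basis l) * cross k l C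
    else 0.
  have [k13 l13] := (ltn_ord k, ltn_ord l).
  have := @weight_block_invariants (weight k) (weight l) (S (re_basis k) (re_basis l))
    (S (re_basis k) (im_basis l)) (S (im_basis k) (re_basis l)) (S (im_basis k) (im_basis l))
    (weight_lt5 k) (weight_lt5 l).
  move: (rotate_re_basis ab1 k13) (rotate_im_basis ab1 k13).
  move: (rotate_re_basis ab1 l13) (rotate_im_basis ab1 l13).
  case: (cpow _ _ (weight k)) => c s; case: (cpow _ _ (weight l)) => c' s' /=.
  move=> rel iml rek imk concl; rewrite SE.
  have {concl} : if weight k == weight l then (0 < weight k)%N ->
      S (im_basis k) (im_basis l) = S (re_basis k) (re_basis l) /\
      S (im_basis k) (re_basis l) = - S (re_basis k) (im_basis l)
    else [/\ S (re_basis k) (re_basis l) = 0, S (re_basis k) (im_basis l) = 0,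
             S (im_basis k) (re_basis l) = 0 & S (im_basis k) (im_basis l) = 0].
    (* The four equations required are the invariance of [S] on the four pairs of basis tensors. *)
    by apply: concl; rewrite -SE -?rek -?imk -?rel -?iml S_inv.
  case: eqP => [wkl|_ [-> -> -> ->]]; last by ring.
  (* For positive weight the block is a combination of the two parts of conj(z_k) z_l; for weight 0
     only the product of the real coordinates is left. *)
  case: (posnP (weight k)) => [wk0 _|_ /(_ isT)[-> ->]]; last by rewrite /dot /cross; ring.
  have wl0 : weight l = 0%N by rewrite -wkl.
  rewrite /dot /cross (im_basis_scalar (weight_eq0 k13 wk0))
    (im_basis_scalar (weight_eq0 l13 wl0)).
  by rewrite !im_scalar ?weight_eq0 // !(S0l, S0r); ring.
(* Expansion of [phi C] = S(C, C) / 2 along the basis, one block for each pair of coordinates. *)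
have phiS : phi = \sum_(k < 13) \sum_(l < 13) (fun C => 2^-1 *
    S (re k C *: re_basis k + im k C *: im_basis k) (re l C *: re_basis l + im l C *: im_basis l)).
  apply/funext => C.
  have -> : phi C = 2^-1 * S C C by rewrite phiE /S; field.
  rewrite fct_sumE {1 2}[C]basis_expansion.
  have S_sumr D n (F : 'I_n -> elasticity R) : S D (\sum_(l < n) F l) = \sum_(l < n) S D (F l).
    by rewrite /S linear_sumr linear_sumlz -big_split.
  have S_suml D n (F : 'I_n -> elasticity R) : S (\sum_(l < n) F l) D = \sum_(l < n) S (F l) D.
    by rewrite SC S_sumr; apply: eq_bigr => ? _; rewrite SC.
  rewrite S_suml big_distrr; apply: eq_bigr => k _ /=.
  by rewrite fct_sumE S_sumr big_distrr.
have sum_closed n (F : 'I_n -> elasticity R -> R^o) :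
    (forall i, in_span (SO2_forms R) (F i)) -> in_span (SO2_forms R) (\sum_(i < n) F i).
  move=> F_in; under eq_bigr do rewrite -[F _]scale1r.
  exact: lin_closed_sum (in_span_closed _) F_in.
rewrite phiS; apply: (sum_closed) => k; apply: (sum_closed) => l.
case: (eqVneq (weight k) (weight l)) => [wkl|/negPf wkl].
  have [d_in c_in] := in_span_dot_cross (ltn_ord k) (ltn_ord l) wkl.
  pose s : seq (R * (elasticity R -> R^o)) :=
    [:: (2^-1 * S (re_basis k) (re_basis l), dot k l);
        (2^-1 * S (re_basis k) (im_basis l), cross k l)].
  rewrite (_ : (fun C => _) = lincomb s); first exact: lin_closed_lincomb.
  by apply/funext => C; rewrite block wkl eqxx lincombE /=; ring.
rewrite (_ : (fun C => _) = 0); first by case: closed.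
by apply/funext => C; rewrite block wkl mulr0.
Qed.

End Spanning.

(** * The 35 forms as a basis of the quadratic invariants *)

Theorem mainTheorem4 (R : realType) :
  is_basis (SO2_forms R) (SO2_quadratic_invariants R).
Proof.
split; first exact: SO2_forms_lin_indep.
move=> phi; split=> [|[a ->]]; first exact: invariant_in_span.
apply: lin_closed_sum (SO2_quadratic_invariants_closed R) _ => i.
exact: SO2_forms_invariant.
Qed.
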